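(* Let $\alpha$ be any finite set, $\nu$ any involution on $\alpha$, and $m$ a non-negative integer. Then the homomorphism $\Gamma_{m,n}=\hat O_m\circ\hat\theta_n\circ\hat I^{-1}:\mathbb{Z}P(\alpha,\nu,n)\to G_m(\alpha,\nu,n)$ (restricted to $P(\alpha,\nu,n)$) is the universal finite type invariant of degree $m$ for cyclic equivalence classes of $n$-component nanophrases over $\alpha$; that is, it is a finite type invariant of degree $m$, and for every abelian group $H$ and every finite type invariant $v:P(\alpha,\nu,n)\to H$ of degree at most $m$ there is a homomorphism $f:G_m(\alpha,\nu,n)\to H$ with $v=f\circ\Gamma_{m,n}$ on $P(\alpha,\nu,n)$.
   Context: Nanophrases. An $\alpha$-alphabet is a finite set $\mathcal A$ of letters with a map $A\mapsto |A|\in\alpha$ (the projection). An $n$-component nanophrase over $\alpha$ is an $\alpha$-alphabet $\mathcal A$ together with a sequence of $n$ (possibly empty) words on $\mathcal A$, written separated by ''$|$'', such that every letter of $\mathcal A$ occurs exactly twice in total. An isomorphism is a projection-preserving bijection of alphabets carrying the $i$th word to the $i$th word for all $i$. $P(\alpha,n)$ is the set of isomorphism classes. The rank is the number of distinct letters. $\nu$-shift move on the $i$th component: if that component is empty or a single letter, nothing changes; otherwise write it as $Ax$ with $A$ its first letter and replace it by $xA$; moreover, if $x$ contains $A$, then $|A|$ is replaced by $\nu(|A|)$; otherwise projections are unchanged. Cyclic equivalence is the equivalence relation generated by isomorphisms and $\nu$-shift moves; $P(\alpha,\nu,n)$ is the set of cyclic equivalence classes. Singular letters. Let $\alpha^*=\{a^*\mid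 a\in\alpha\}$ be a disjoint copy of $\alpha$ and extend $\nu$ by $\nu(a^* )=\nu(a)^*$. A letter with projection in $\alpha^*$ is called singular (written $A^*$). $P_m(\alpha,\nu,n)$ is the set of cyclic equivalence classes of $n$-component nanophrases over $\alpha\cup\alpha^*$ with exactly $m$ singular letters, and $\mathcal P(\alpha,\nu,n)=\bigcup_{m\ge0}P_m(\alpha,\nu,n)$. An invariant is a map $u:P(\alpha,\nu,n)\to G$ to an abelian group; it has a (well-defined) extension $\hat u:\mathcal P(\alpha,\nu,n)\to G$ determined by $\hat u=u$ on $P_0(\alpha,\nu,n)=P(\alpha,\nu,n)$ and $\hat u(xA^*yA^*z)=\hat u(xAyAz)-\hat u(xyz)$, where $A$ is a non-singular letter with $|A|^*=|A^*|$ and $x,y,z$ are arbitrary sequences possibly including ''$|$''. The map $u$ is a finite type invariant if there is $m\ge0$ such that $\hat u(p)=0$ for all $p$ with more than $m$ singular letters; the minimal such $m$ is its degree. Construction of $\Gamma_{m,n}$. $\mathbb{Z}P(\alpha,n)$ and $\mathbb{Z}P(\alpha,\nu,n)$ are the free abelian groups on $P(\alpha,n)$ and $P(\alpha,\nu,n)$. $G(\alpha,\nu,n)$ is the quotient of $\mathbb{Z}P(\alpha,n)$ by the relations $w|AxAy|t-w|xByB|t=0$ with $|B|=\nu(|A|)$, and $w|Az|t-w|zA|t=0$, where $x,y,z$ do not contain ''$|$'' and $z$ does not contain $A$ (here $w,t$ stand for the remaining components). The natural projection $I:\mathbb{Z}P(\alpha,n)\to\mathbb{Z}P(\alpha,\nu,n)$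 induces an isomorphism $\hat I:G(\alpha,\nu,n)\to\mathbb{Z}P(\alpha,\nu,n)$. A subphrase $q\triangleleft p$ is a nanophrase obtained from $p$ by deleting both occurrences of each letter in some (possibly empty) set of letters, keeping projections of the others; a phrase of rank $k$ has exactly $2^k$ subphrases (one per subset of letters, counted separately even if isomorphic). $\theta_n:\mathbb{Z}P(\alpha,n)\to\mathbb{Z}P(\alpha,n)$ is the linear map $\theta_n(p)=\sum_{q\triangleleft p}q$; it induces an isomorphism $\hat\theta_n$ of $G(\alpha,\nu,n)$. $G_m(\alpha,\nu,n)$ is the quotient of $G(\alpha,\nu,n)$ by the relations $p=0$ for all nanophrases $p$ with $\mathrm{rank}(p)>m$. $\hat O_m:G(\alpha,\nu,n)\to G_m(\alpha,\nu,n)$ is induced by the linear map sending a nanophrase $p$ to $p$ if $\mathrm{rank}(p)\le m$ and to $0$ otherwise (i.e. it is the quotient map).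
   Formalization: That the degree is exactly m is claimed only if m = 0 or both n > 0 and α is non-empty (otherwise the only nanophrase is trivial and every invariant has degree 0); vanishing on more than m singular letters and universality are proved for all α, n, m. *)

(* Defs.v *)
From HB Require Import structures.
From Stdlib Require Import Relation_Operators.
From mathcomp Require Import all_boot all_order all_algebra.
From mathcomp Require Import finmap generic_quotient ring_quotient freeg boolp.

Set Implicit Arguments.
Unset Strict Implicit.
Unset Printing Implicit Defensive.

Import GRing.Theory.

Local Open Scope quotient_scope.
Local Open Scope fset_scope.
Local Open Scope fmap_scope.
Local Open Scope ring_scope.

Section Nanophrase.
Variables (alpha : choiceType) (n : nat).

(* A pair (w, f) stands for the sequence of words w 0 | ... | w (n - 1) on the
   alpha-alphabet whose set of letters is domf f and whose projection is f.
   Letters are taken in the countable set nat: every finite alphabet is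
   isomorphic to such a one, so no isomorphism class is lost. *)
Definition nanophrase_axiom
    (p : {ffun 'I_n -> seq nat} * {fmap nat -> alpha}) : bool :=
  [forall i, all (fun A => A \in domf p.2) (p.1 i)]
  && all (fun A => \sum_(i < n) count_mem A (p.1 i) == 2)%N (domf p.2).

Record nanophrase := Nanophrase {
  nanophrase_val : {ffun 'I_n -> seq nat} * {fmap nat -> alpha};
  _ : nanophrase_axiom nanophrase_val
}.

HB.instance Definition _ := [isSub for nanophrase_val].
HB.instance Definition _ := [Choice of nanophrase by <:].

Definition word (p : nanophrase) (i : 'I_n) : seq nat := (val p).1 i.
Definition proj (p : nanophrase) : {fmap nat -> alpha} := (val p).2.
Definition alphabet (p : nanophrase) : {fset nat} := domf (proj p).
Definition rank (p : nanophrase) : nat := #|` alphabet p|.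

Lemma nanophrase_eq (p q : nanophrase) :
  word p =1 word q -> proj p = proj q -> p = q.
Proof.
case: p q => [[w f] Hp] [[w' f'] Hq] /= e1 e2; apply: val_inj => /=.
by congr pair => //; apply/ffunP.
Qed.

Lemma word_sub (p : nanophrase) i A : A \in word p i -> A \in alphabet p.
Proof. by move=> Ai; have /andP[/forallP/(_ i)/allP/(_ _ Ai)] := valP p. Qed.

Lemma count_letter (p : nanophrase) A :
  (\sum_(i < n) count_mem A (word p i) = (A \in alphabet p).*2)%N.
Proof.
have /andP[_ /allP H] := valP p.
have [Ap|Ap] := boolP (A \in alphabet p); first exact/eqP/H.
rewrite big1 // => i _; apply/eqP; rewrite -leqn0 leqNgt -has_count has_pred1.
by apply: contra Ap => /word_sub.
Qed.

Lemma nanophrase_axiomP (w : {ffun 'I_n -> seq nat}) (f : {fmap nat -> alpha}) :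
  (forall A, \sum_(i < n) count_mem A (w i) = (A \in domf f).*2)%N ->
  nanophrase_axiom (w, f).
Proof.
move=> H; apply/andP; split => /=; last by apply/allP => A; rewrite H => ->.
apply/forallP => i; apply/allP => A Ai; move: (H A); rewrite (bigD1 i) //=.
by case: (A \in domf f) => //; move: Ai; rewrite -has_pred1 has_count; case: count.
Qed.

Definition isomorphic (p q : nanophrase) : Prop :=
  exists f : nat -> nat,
    [/\ {in alphabet p &, injective f},
        alphabet q = f @` alphabet p,
        {in alphabet p, forall A, (proj q).[? f A] = (proj p).[? A]}
      & forall i, word q i = [seq f A | A <- word p i]].

Lemma isomorphic_refl p : isomorphic p p.
Proof.
exists id; split => //; first by rewrite imfset_id.
by move=> i; rewrite map_id.
Qed.

Lemma isomorphic_sym p q : isomorphic p q -> isomorphic q p.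
Proof.
case=> f [f_inj alphq projq wordq].
pose g B := if [pick A : alphabet p | f (val A) == B] is Some A then val A else 0%N.
have fK A : A \in alphabet p -> g (f A) = A.
  move=> Ap; rewrite /g; case: pickP => [A' /eqP e|/(_ [` Ap])]; last by rewrite eqxx.
  exact: f_inj (valP A') Ap e.
exists g; split.
- by move=> A B; rewrite alphq => /imfsetP[/= a ap ->] /imfsetP[/= b bp ->]; rewrite !fK // => ->.
- apply/fsetP => A; apply/idP/imfsetP => /= [Ap|[B]].
    by exists (f A); rewrite ?fK // alphq; apply: in_imfset.
  by rewrite alphq => /imfsetP[/= a ap ->] ->; rewrite fK.
- by move=> B; rewrite alphq => /imfsetP[/= a ap ->]; rewrite fK // projq //.
move=> i; rewrite wordq -map_comp -[LHS]map_id; apply/eq_in_map => A /word_sub Ap /=.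
by rewrite fK.
Qed.

Lemma isomorphic_trans p q r : isomorphic p q -> isomorphic q r -> isomorphic p r.
Proof.
case=> f [f_inj alphq projq wordq] [g [g_inj alphr projr wordr]].
have fq A : A \in alphabet p -> f A \in alphabet q.
  by move=> Ap; rewrite alphq; apply: in_imfset.
exists (g \o f); split.
- by move=> A B Ap Bp /g_inj => /(_ (fq _ Ap) (fq _ Bp)); apply: f_inj.
- apply/fsetP => A; rewrite alphr alphq; apply/imfsetP/imfsetP => /= [[B]|[B Bp ->]].
    by case/imfsetP => /= C Cp -> ->; exists C.
  by exists (f B); rewrite ?in_imfset.
- by move=> A Ap; rewrite /= projr ?fq // projq //.
by move=> i; rewrite wordr wordq -map_comp.
Qed.

Definition isob (p q : nanophrase) : bool := `[< isomorphic p q >].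

Lemma isob_equiv : equiv_class_of isob.
Proof.
split => [p|p q|q p r]; first exact/asboolP/isomorphic_refl.
  by apply/idP/idP => /asboolP /isomorphic_sym H; apply/asboolP.
by move=> /asboolP pq /asboolP qr; apply/asboolP; apply: isomorphic_trans qr.
Qed.

Canonical isob_equivRel := EquivRelPack isob_equiv.
Canonical isob_encModRel := defaultEncModRel isob.

Definition P := {eq_quot isob}.
HB.instance Definition _ : EqQuotient nanophrase isob P := EqQuotient.on P.
HB.instance Definition _ := Choice.on P.

Definition iso_class (p : nanophrase) : P := \pi p.

Lemma iso_classP p q : reflect (isomorphic p q) (iso_class p == iso_class q).
Proof. by rewrite /iso_class piE; apply: asboolP. Qed.

Lemma repr_iso_class p : isomorphic p (repr (iso_class p)).
Proof. by apply/iso_classP; rewrite /iso_class reprK. Qed.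

End Nanophrase.

Arguments Nanophrase {alpha n}.

Section Operations.
Variable n : nat.

Definition map_proj_val (alpha beta : choiceType) (g : nat -> alpha -> beta)
    (p : nanophrase alpha n) : {ffun 'I_n -> seq nat} * {fmap nat -> beta} :=
  ((val p).1, [fmap A : alphabet p => g (val A) (proj p A)]).

Lemma map_proj_subproof alpha beta g p :
  nanophrase_axiom (@map_proj_val alpha beta g p).
Proof. by apply: nanophrase_axiomP => A; rewrite count_letter. Qed.

Definition map_proj (alpha beta : choiceType) (g : nat -> alpha -> beta)
    (p : nanophrase alpha n) : nanophrase beta n :=
  Nanophrase _ (map_proj_subproof g p).

Variable alpha : choiceType.

Definition delete_val (S : {fset nat}) (p : nanophrase alpha n) :
    {ffun 'I_n -> seq nat} * {fmap nat -> alpha} :=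
  ([ffun i => [seq A <- word p i | A \notin S]], (proj p).[\ S]).

Lemma delete_subproof S p : nanophrase_axiom (delete_val S p).
Proof.
apply: nanophrase_axiomP => A /=.
have -> : (A \in domf (proj p).[\ S]) = (A \notin S) && (A \in alphabet p).
  rewrite /= !inE; by case: (A \in S); case: (A \in alphabet p).
have [AS|AS] := boolP (A \in S).
  rewrite big1 // => i _; rewrite ffunE; apply/count_memPn.
  by rewrite mem_filter AS.
rewrite -count_letter; apply: eq_bigr => i _; rewrite ffunE count_filter.
by apply: eq_count => B /=; case: eqP => //= ->.
Qed.

(* The subphrases of p are the delete S p, for S a subset of alphabet p. *)
Definition delete (S : {fset nat}) (p : nanophrase alpha n) : nanophrase alpha n :=
  Nanophrase _ (delete_subproof S p).

Definition starts_and_recurs (A : nat) (s : seq nat) : bool :=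
  if s is B :: x then (B == A) && (B \in x) else false.

Definition shift_val (nu : alpha -> alpha) (i : 'I_n) (p : nanophrase alpha n) :
    {ffun 'I_n -> seq nat} * {fmap nat -> alpha} :=
  ([ffun j => if j == i then rot 1 (word p j) else word p j],
   proj (map_proj (fun A a => if starts_and_recurs A (word p i) then nu a else a) p)).

Lemma shift_subproof nu i p : nanophrase_axiom (shift_val nu i p).
Proof.
apply: nanophrase_axiomP => A; rewrite -[RHS]count_letter; apply: eq_bigr => j _ /=.
by rewrite ffunE; case: eqP => // ->; apply/permP; rewrite perm_rot.
Qed.

Definition shift (nu : alpha -> alpha) (i : 'I_n) (p : nanophrase alpha n) :
    nanophrase alpha n :=
  Nanophrase _ (shift_subproof nu i p).

End Operations.

Section CyclicEquivalence.
Variables (alpha : choiceType) (nu : alpha -> alpha) (n : nat).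
Implicit Types p q : nanophrase alpha n.

Definition cyc_step p q : Prop := isomorphic p q \/ exists i, q = shift nu i p.

Definition cyc_equivalent : nanophrase alpha n -> nanophrase alpha n -> Prop :=
  clos_refl_sym_trans _ cyc_step.

Definition cycb p q : bool := `[< cyc_equivalent p q >].

Lemma cycb_equiv : equiv_class_of cycb.
Proof.
split => [p|p q|q p r]; first exact/asboolP/rst_refl.
  by apply/idP/idP => /asboolP H; apply/asboolP/rst_sym.
by move=> /asboolP pq /asboolP qr; apply/asboolP; apply: rst_trans qr.
Qed.

Canonical cycb_equivRel := EquivRelPack cycb_equiv.
Canonical cycb_encModRel := defaultEncModRel cycb.

Definition PC := {eq_quot cycb}.
HB.instance Definition _ : EqQuotient (nanophrase alpha n) cycb PC := EqQuotient.on PC.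
HB.instance Definition _ := Choice.on PC.

Definition cyc_class p : PC := \pi p.

Lemma cyc_classP p q : reflect (cyc_equivalent p q) (cyc_class p == cyc_class q).
Proof. by rewrite /cyc_class piE; apply: asboolP. Qed.

Lemma cyc_class_iso p q : isomorphic p q -> cyc_class p = cyc_class q.
Proof. by move=> pq; apply/eqP/cyc_classP/rst_step; left. Qed.

Lemma cyc_class_shift i p : cyc_class (shift nu i p) = cyc_class p.
Proof. by apply/esym/eqP/cyc_classP/rst_step; right; exists i. Qed.

End CyclicEquivalence.

(* Over alpha + alpha, inl a is a itself and inr a is its copy a^*. *)
Definition star (alpha : Type) (nu : alpha -> alpha) (b : alpha + alpha) : alpha + alpha :=
  match b with inl a => inl (nu a) | inr a => inr (nu a) end.

Definition is_singular (alpha : Type) (b : alpha + alpha) : bool :=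
  if b is inr _ then true else false.

Section Subgroup.
Variables (V : zmodType) (R : V -> Prop).

Inductive span : V -> Prop :=
| span0 : span 0
| span_rel r : R r -> span r
| spanB x y : span x -> span y -> span (x - y).

Definition spanb : {pred V} := fun x => `[< span x >].

Lemma spanb_zmod_closed : zmod_closed spanb.
Proof.
split; first exact/asboolP/span0.
by move=> x y /asboolP xR /asboolP yR; apply/asboolP/spanB.
Qed.

HB.instance Definition _ := GRing.isZmodClosed.Build V spanb spanb_zmod_closed.

Definition zmod_quot := Quotient.quot spanb.
HB.instance Definition _ : EqQuotient V (Quotient.equiv spanb) zmod_quot :=
  EqQuotient.on zmod_quot.
HB.instance Definition _ := GRing.Zmodule.on zmod_quot.

Definition quot_proj (x : V) : zmod_quot := \pi x.

Lemma quot_proj_is_zmod_morphism : zmod_morphism quot_proj.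
Proof. exact: (raddfB (\pi_(Quotient.quot spanb))). Qed.

HB.instance Definition _ :=
  GRing.isZmodMorphism.Build V zmod_quot quot_proj quot_proj_is_zmod_morphism.

Lemma quot_proj_eq0 r : R r -> quot_proj r = 0.
Proof.
move=> Rr; apply/eqP; rewrite -(raddf0 quot_proj) /quot_proj.
by rewrite -[_ == _]Quotient.idealrBE subr0; apply/asboolP/span_rel.
Qed.

Lemma quot_projP x y : quot_proj x = quot_proj y -> span (x - y).
Proof. by move/eqP; rewrite -[_ == _]Quotient.idealrBE => /asboolP. Qed.

Variables (W : zmodType) (f : {additive V -> W}).

Definition quot_lift (fR : forall r, R r -> f r = 0) (x : zmod_quot) : W :=
  f (repr x).

Lemma quot_liftE fR x : quot_lift fR (quot_proj x) = f x.
Proof.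
apply/eqP; rewrite -subr_eq0 -raddfB; apply/eqP.
have : span (repr (quot_proj x) - x) by apply: quot_projP; rewrite /quot_proj reprK.
by elim=> [|r /fR //|a b _ fa _ fb]; rewrite ?raddf0 // raddfB fa fb subr0.
Qed.

Lemma quot_proj_surj (x : zmod_quot) : exists y, x = quot_proj y.
Proof. by exists (repr x); rewrite /quot_proj reprK. Qed.

Lemma quot_lift_is_zmod_morphism fR : zmod_morphism (quot_lift fR).
Proof.
move=> x y; have [a ->] := quot_proj_surj x; have [b ->] := quot_proj_surj y.
by rewrite -raddfB !quot_liftE raddfB.
Qed.

HB.instance Definition _ fR :=
  GRing.isZmodMorphism.Build zmod_quot W (quot_lift fR)
    (quot_lift_is_zmod_morphism fR).

End Subgroup.

Section FreeLift.
Variables (K : choiceType) (W : zmodType) (f : K -> W).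

Definition free_lift : {freeg K / int} -> W := fglift (f : K -> zmodule W).

Lemma free_lift_is_zmod_morphism : zmod_morphism free_lift.
Proof. exact: (@lift_is_additive int K (zmodule W) f). Qed.

HB.instance Definition _ :=
  GRing.isZmodMorphism.Build {freeg K / int} W free_lift free_lift_is_zmod_morphism.

Lemma free_liftE k : free_lift << k >> = f k.
Proof. by rewrite /free_lift liftU scale1r. Qed.

End FreeLift.

Lemma free_hom_eq (K : choiceType) (W : zmodType) (f g : {additive {freeg K / int} -> W}) :
  (forall k, f << k >> = g << k >>) -> f =1 g.
Proof.
move=> fg x; rewrite -(freeg_sumE x) !raddf_sum; apply: eq_bigr => k _.
by rewrite -[coeff k x]intz -freegU_mulz !raddfMz fg.
Qed.

Section Projections.
Variable n : nat.
Implicit Types alpha beta : choiceType.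

Lemma fnd_map_proj alpha beta (g : nat -> alpha -> beta) (p : nanophrase alpha n) A :
  (proj (map_proj g p)).[? A] = omap (g A) (proj p).[? A].
Proof.
rewrite /proj /=; case: (fndP (val p).2 A) => Ap /=; last by rewrite not_fnd.
by rewrite in_fnd ffunE.
Qed.

Lemma fnd_shift alpha nu i (p : nanophrase alpha n) A :
  (proj (shift nu i p)).[? A] =
  omap (fun a => if starts_and_recurs A (word p i) then nu a else a) (proj p).[? A].
Proof. exact: (fnd_map_proj _ p). Qed.

Lemma fnd_delete alpha S (p : nanophrase alpha n) A :
  (proj (delete S p)).[? A] = if A \in S then None else (proj p).[? A].
Proof. exact: fnd_rem. Qed.

Lemma word_map_proj alpha beta (g : nat -> alpha -> beta) (p : nanophrase alpha n) i :
  word (map_proj g p) i = word p i.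
Proof. by []. Qed.

Lemma word_delete alpha S (p : nanophrase alpha n) i :
  word (delete S p) i = [seq A <- word p i | A \notin S].
Proof. by rewrite /word /= ffunE. Qed.

Lemma word_shift alpha nu i (p : nanophrase alpha n) j :
  word (shift nu i p) j = if j == i then rot 1 (word p j) else word p j.
Proof. by rewrite /word /= ffunE. Qed.

Lemma alphabet_delete alpha S (p : nanophrase alpha n) :
  alphabet (delete S p) = alphabet p `\` S.
Proof.
by apply/fsetP => A; rewrite /alphabet /= !inE; case: (A \in S); case: (A \in _).
Qed.

Lemma nanophrase_eqP alpha (p q : nanophrase alpha n) :
  word p =1 word q -> (forall A, (proj p).[? A] = (proj q).[? A]) -> p = q.
Proof. by move=> wpq ppq; apply: nanophrase_eq => //; apply/fmapP. Qed.

Lemma fnd_alphabet alpha (p : nanophrase alpha n) A : (proj p).[? A] = None <-> A \notin alphabet p.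
Proof. by split => [|H]; [case: fndP | exact: not_fnd]. Qed.

Lemma isomorphic_delete alpha (p q : nanophrase alpha n) (f : nat -> nat) S :
  {in alphabet p &, injective f} -> alphabet q = f @` alphabet p ->
  {in alphabet p, forall A, (proj q).[? f A] = (proj p).[? A]} ->
  (forall i, word q i = [seq f A | A <- word p i]) ->
  S `<=` alphabet p -> isomorphic (delete S p) (delete (f @` S) q).
Proof.
move=> f_inj alphq projq wordq /fsubsetP Sp; exists f.
have fS A : A \in alphabet p -> (f A \in f @` S) = (A \in S).
  move=> Ap; apply/imfsetP/idP => /= [[B BS]|AS]; last by exists A.
  by move/f_inj => -> //; apply: Sp.
split.
- move=> A B; rewrite !alphabet_delete !inE => /andP[_ Ap] /andP[_ Bp].
  exact: f_inj.
- apply/fsetP => B; rewrite !alphabet_delete alphq !inE.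
  apply/andP/imfsetP => /= [[BS /imfsetP[/= A Ap e]]|[A]].
    by exists A => //; rewrite !inE Ap andbT -fS // -e.
  by rewrite !inE => /andP[AS Ap] ->; rewrite fS // AS; split=> //; apply: in_imfset.
- move=> A; rewrite alphabet_delete !inE => /andP[AS Ap].
  by rewrite !fnd_delete fS // (negPf AS) projq.
move=> i; rewrite !word_delete wordq filter_map; congr map.
by apply: eq_in_filter => A /word_sub Ap /=; rewrite fS.
Qed.

Lemma delete_shift alpha nu i S (p : nanophrase alpha n) :
  delete S (shift nu i p) = delete S p \/
  delete S (shift nu i p) = shift nu i (delete S p).
Proof.
case wi: (word p i) => [|A x].
  left; apply: nanophrase_eqP => [j|B].
    rewrite !word_delete word_shift; case: eqP => // ->; by rewrite wi.
  by rewrite !fnd_delete fnd_shift wi /=; case: ifP => //; case: (proj p).[? B].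
have [AS|AS] := boolP (A \in S).
  left; apply: nanophrase_eqP => [j|B].
    rewrite !word_delete word_shift; case: eqP => // ->.
    by rewrite wi rot1_cons filter_rcons /= AS.
  rewrite !fnd_delete fnd_shift wi /=.
  by case: ifP => // BS; case: eqP BS => [<-|]; [rewrite AS|case: (proj p).[? B]].
right; apply: nanophrase_eqP => [j|B].
  rewrite !(word_delete, word_shift); case: eqP => // ->.
  by rewrite wi /= AS !rot1_cons filter_rcons AS.
rewrite !(fnd_delete, fnd_shift) word_delete wi /= AS /= mem_filter AS /=.
by case: ifP.
Qed.

Lemma big_fpowerset_imfset (W : zmodType) (f : nat -> nat) (X : {fset nat})
    (F : {fset nat} -> W) :
  {in X &, injective f} ->
  \sum_(S <- fpowerset (f @` X)) F S = \sum_(S <- fpowerset X) F (f @` S).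
Proof.
move=> f_inj; rewrite -(big_map (fun S : {fset nat} => f @` S) xpredT F).
apply: perm_big; apply: uniq_perm; first exact: fset_uniq.
  rewrite map_inj_in_uniq ?fset_uniq // => S T; rewrite !fpowersetE.
  have sub (U V : {fset nat}) : U `<=` X -> V `<=` X -> f @` U = f @` V -> U `<=` V.
    move=> /fsubsetP UX /fsubsetP VX UV; apply/fsubsetP => A AU.
    have /imfsetP[/= B BV e] : f A \in f @` V by rewrite -UV in_imfset.
    by rewrite (f_inj _ _ (UX _ AU) (VX _ BV) e).
  by move=> SX TX e; apply/eqP; rewrite eqEfsubset (sub S T) ?(sub T S).
move=> S; rewrite fpowersetE; apply/idP/mapP => [SX|[T]].
  exists [fset A in X | f A \in S].
    by rewrite fpowersetE; apply/fsubsetP => A; rewrite !inE => /andP[].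
  apply/fsetP => B; apply/idP/imfsetP => [BS|[/= A]].
    have /imfsetP[/= A AX e] := fsubsetP SX _ BS.
    by exists A => //; rewrite !inE AX -e.
  by rewrite !inE => /andP[_ AS] ->.
rewrite fpowersetE => /fsubsetP TX ->; apply/fsubsetP => B /imfsetP[/= A /TX AX ->].
exact: in_imfset.
Qed.

End Projections.

Section Gamma.
Variables (alpha : choiceType) (nu : alpha -> alpha) (n : nat).
Implicit Types p q : nanophrase alpha n.

Local Notation ZP := {freeg (P alpha n) / int}.
Local Notation ZPC := {freeg (PC nu n) / int}.

(* w | AxAy | t  -  w | xByB | t with |B| = nu |A|, and w | Az | t  -  w | zA | t,
   the displayed component being the i-th one. *)
Inductive cyc_relator : ZP -> Prop :=
| Double p q (i : 'I_n) A B x y :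
    word p i = A :: x ++ A :: y ->
    word q i = x ++ B :: y ++ [:: B] ->
    (forall j, j != i -> word q j = word p j) ->
    (proj q).[? B] = omap nu (proj p).[? A] ->
    (forall C, C != A -> C != B -> (proj q).[? C] = (proj p).[? C]) ->
    cyc_relator (<< iso_class p >> - << iso_class q >>)
| Single p q (i : 'I_n) A z :
    word p i = A :: z ->
    A \notin z ->
    word q i = z ++ [:: A] ->
    (forall j, j != i -> word q j = word p j) ->
    proj q = proj p ->
    cyc_relator (<< iso_class p >> - << iso_class q >>).

Definition G := zmod_quot cyc_relator.
HB.instance Definition _ := GRing.Zmodule.on G.

Definition Ihom : ZP -> ZPC := free_lift (fun c : P alpha n => << cyc_class nu (repr c) >>).
HB.instance Definition _ := GRing.Additive.on Ihom.

Lemma IhomE p : Ihom << iso_class p >> = << cyc_class nu p >>.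
Proof.
rewrite /Ihom free_liftE; congr (<< _ >>); apply: cyc_class_iso.
exact/isomorphic_sym/repr_iso_class.
Qed.

Lemma single_shift p q (i : 'I_n) A z :
  word p i = A :: z -> A \notin z -> word q i = z ++ [:: A] ->
  (forall j, j != i -> word q j = word p j) -> proj q = proj p ->
  q = shift nu i p.
Proof.
move=> wp Az wq wpq ppq; apply: nanophrase_eqP => [j|B].
  by rewrite word_shift; case: eqVneq => [->|/wpq//]; rewrite wp wq rot1_cons cats1.
by rewrite fnd_shift ppq wp /= (negPf Az) andbF; case: (proj p).[? B].
Qed.

Lemma count_other p i A : count_mem A (word p i) = 2%N ->
  forall j, j != i -> A \notin word p j.
Proof.
move=> Ai j ji; apply/count_memPn; have := count_letter p A.
rewrite (bigD1 i) //= (bigD1 j) //= Ai.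
by case: (A \in alphabet p); case: (count_mem A (word p j)).
Qed.

Lemma double_shift p q (i : 'I_n) A B x y :
  word p i = A :: x ++ A :: y -> word q i = x ++ B :: y ++ [:: B] ->
  (forall j, j != i -> word q j = word p j) ->
  (proj q).[? B] = omap nu (proj p).[? A] ->
  (forall C, C != A -> C != B -> (proj q).[? C] = (proj p).[? C]) ->
  isomorphic (shift nu i p) q.
Proof.
move=> wp wq wpq ppqA ppq.
have cp C : (count_mem C (word p i) <= 2)%N.
  have := count_letter p C; rewrite (bigD1 i) //=.
  by case: (C \in alphabet p) => /=; case: (count_mem C _) => [|[|[]]].
have cq C : (count_mem C (word q i) <= 2)%N.
  have := count_letter q C; rewrite (bigD1 i) //=.
  by case: (C \in alphabet q) => /=; case: (count_mem C _) => [|[|[]]].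
have Axy : (A \notin x) && (A \notin y).
  have := cp A; rewrite wp /= count_cat /= eqxx -!has_pred1 !has_count.
  by case: (count _ x) => [|?]; case: (count _ y) => [|?]; rewrite ?(addSn, addnS).
have Bxy : (B \notin x) && (B \notin y).
  have := cq B; rewrite wq count_cat /= count_cat /= eqxx -!has_pred1 !has_count.
  by case: (count _ x) => [|?]; case: (count _ y) => [|?]; rewrite ?(addSn, addnS).
have [/negPf Ax /negPf Ay] := andP Axy; have [/negPf Bx /negPf By] := andP Bxy.
have Aj j : j != i -> A \notin word p j.
  apply: count_other; rewrite wp /= count_cat /= eqxx.
  by rewrite (count_memPn _) ?Ax // (count_memPn _) ?Ay.
have Bj j : j != i -> B \notin word q j.
  apply: count_other; rewrite wq count_cat /= count_cat /= eqxx.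
  by rewrite (count_memPn _) ?Bx // (count_memPn _) ?By.
have mem_alph r (C : nat) : C \in alphabet r -> exists j, C \in word r j.
  move=> Cr; apply/existsP; apply: contraT; rewrite negb_exists => /forallP H.
  have := count_letter r C; rewrite Cr big1 // => j _; exact/count_memPn.
have Bp : B \in alphabet p -> B = A.
  case/mem_alph => j; have [->|ji] := eqVneq j i; last first.
    by rewrite -wpq // (negPf (Bj _ ji)).
  by rewrite wp !(inE, mem_cat) Bx By orbF /= orbb => /eqP.
have Aq : A \in alphabet q -> B = A.
  case/mem_alph => j; have [->|ji] := eqVneq j i; last first.
    by rewrite wpq // (negPf (Aj _ ji)).
  by rewrite wq !(inE, mem_cat) Ax Ay /= orbb => /eqP.
have Ap : A \in alphabet p by apply: (@word_sub _ _ _ i); rewrite wp mem_head.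
have Bq : B \in alphabet q.
  by apply: (@word_sub _ _ _ i); rewrite wq mem_cat inE eqxx orbT.
have alph_shift : alphabet (shift nu i p) = alphabet p by [].
have mapC s : A \notin s -> [seq (if C == A then B else C) | C <- s] = s.
  move=> As; rewrite -[RHS]map_id; apply/eq_in_map => C Cs.
  by case: eqP Cs As => // -> ->.
exists (fun C => if C == A then B else C); split.
- move=> C D; rewrite alph_shift => Cp Dp.
  case: (eqVneq C A) => [->|CA]; case: (eqVneq D A) => [->|DA] // e.
    by move: Dp DA; rewrite -e => /Bp ->; rewrite eqxx.
  by move: Cp CA; rewrite e => /Bp ->; rewrite eqxx.
- rewrite alph_shift; apply/fsetP => C; apply/idP/imfsetP => /= [Cq|[D Dp ->]].
    have [CB|CB] := eqVneq C B; first by exists A; rewrite ?eqxx.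
    have [CA|CA] := eqVneq C A; first by move: Cq CB; rewrite CA => /Aq ->; rewrite eqxx.
    exists C; last by rewrite (negPf CA).
    by apply: contraT => /fnd_alphabet; rewrite -ppq // => /fnd_alphabet; rewrite Cq.
  have [//|DA] := eqVneq D A.
  have [->//|DB] := eqVneq D B.
  by apply: contraT => /fnd_alphabet; rewrite ppq // => /fnd_alphabet; rewrite Dp.
- move=> C; rewrite alph_shift => Cp; rewrite fnd_shift wp /= mem_cat mem_head orbT andbT.
  rewrite [A == C]eq_sym.
  have [->|CA] := eqVneq C A; first by rewrite ppqA.
  rewrite ppq //; first by case: (proj p).[? C].
  by apply: contraNneq CA => CB; move: Cp; rewrite CB => /Bp ->.
move=> j; rewrite word_shift; have [->|ji] := eqVneq j i; last first.
  by rewrite mapC ?Aj // wpq.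
rewrite wp wq rot1_cons map_rcons map_cat /= eqxx.
by rewrite !mapC ?Ax ?Ay // rcons_cat /= -cats1.
Qed.

Lemma Ihom_relator r : cyc_relator r -> Ihom r = 0.
Proof.
case=> [p q i A B x y wp wq wpq ppqA ppq|p q i A z wp Az wq wpq ppq].
  apply/eqP; rewrite raddfB subr_eq0 /= !IhomE; apply/eqP; congr (<< _ >>).
  by rewrite -(cyc_class_iso nu (double_shift wp wq wpq ppqA ppq)) cyc_class_shift.
rewrite (single_shift wp Az wq wpq ppq) raddfB /= !IhomE.
by rewrite cyc_class_shift subrr.
Qed.

Definition Ihat : G -> ZPC := quot_lift Ihom_relator.
HB.instance Definition _ := GRing.Additive.on Ihat.

Lemma IhatE p : Ihat (quot_proj cyc_relator << iso_class p >>) = << cyc_class nu p >>.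
Proof. by rewrite /Ihat quot_liftE /= IhomE. Qed.

Lemma G_shift i p :
  quot_proj cyc_relator << iso_class (shift nu i p) >> =
  quot_proj cyc_relator << iso_class p >>.
Proof.
apply/esym/eqP; rewrite -subr_eq0 -raddfB.
case wp : (word p i) => [|A x].
  suff -> : shift nu i p = p by rewrite subrr raddf0.
  apply: nanophrase_eqP => [j|B]; first by rewrite word_shift; case: eqP => // ->; rewrite wp.
  by rewrite fnd_shift wp /=; case: (proj p).[? B].
apply/eqP/quot_proj_eq0; have [Ax|Ax] := boolP (A \in x); last first.
  apply: (@Single p _ i A x) => //; first by rewrite word_shift eqxx wp rot1_cons cats1.
    by move=> j ji; rewrite word_shift (negPf ji).
  apply/fmapP => B; rewrite fnd_shift wp /= (negPf Ax) andbF.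
  by case: (proj p).[? B].
case/splitPr: Ax wp => x1 x2 wp.
apply: (@Double p _ i A A x1 x2) => //.
- by rewrite word_shift eqxx wp rot1_cons -cats1 -catA.
- by move=> j ji; rewrite word_shift (negPf ji).
- rewrite fnd_shift wp /= mem_cat mem_head orbT eqxx.
  by case: (proj p).[? A].
move=> C CA _; rewrite fnd_shift wp /= eq_sym (negPf CA) /=.
by case: (proj p).[? C].
Qed.

Lemma G_cyc p q : cyc_equivalent nu p q ->
  quot_proj cyc_relator << iso_class p >> = quot_proj cyc_relator << iso_class q >>.
Proof.
elim=> {p q} [p q [/iso_classP/eqP->//|[i ->]]|//|p q _ -> //|p q r _ -> _ -> //].
by rewrite G_shift.
Qed.

Lemma Ihat_bij : bijective Ihat.
Proof.
pose J : ZPC -> G := free_lift (fun c : PC nu n => quot_proj cyc_relator << iso_class (repr c) >>).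
have J_add : zmod_morphism J by exact: raddfB.
pose JA : {additive ZPC -> G} := HB.pack J (GRing.isZmodMorphism.Build _ _ J J_add).
have JE p : J << cyc_class nu p >> = quot_proj cyc_relator << iso_class p >>.
  rewrite /J free_liftE; apply: G_cyc; apply/cyc_classP.
  by rewrite /cyc_class reprK.
exists J => x.
  have [y ->] := quot_proj_surj x.
  apply: (@free_hom_eq _ _ (JA \o Ihat \o quot_proj cyc_relator) (quot_proj cyc_relator)).
  by move=> c /=; rewrite -[c]reprK IhatE JE.
apply: (@free_hom_eq _ _ (Ihat \o JA) idfun) => c /=.
by rewrite -[c]reprK -/(cyc_class nu _) JE IhatE.
Qed.

Lemma Ihat_surj (y : ZPC) : exists x, Ihat x == y.
Proof. by have [J _ IJ] := Ihat_bij; exists (J y); rewrite IJ. Qed.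

Definition Ihat_inv (y : ZPC) : G := xchoose (Ihat_surj y).

Lemma Ihat_invK : cancel Ihat_inv Ihat.
Proof. by move=> y; exact: (eqP (xchooseP (Ihat_surj y))). Qed.

Lemma IhatK : cancel Ihat Ihat_inv.
Proof. by move=> x; apply: (bij_inj Ihat_bij); rewrite Ihat_invK. Qed.

Lemma Ihat_inv_is_zmod_morphism : zmod_morphism Ihat_inv.
Proof.
by move=> x y; apply: (bij_inj Ihat_bij); rewrite raddfB /= !Ihat_invK.
Qed.

HB.instance Definition _ :=
  GRing.isZmodMorphism.Build ZPC G Ihat_inv Ihat_inv_is_zmod_morphism.

Definition subphrase_sum p : ZP :=
  \sum_(S <- fpowerset (alphabet p)) << iso_class (delete S p) >>.

Definition theta : ZP -> ZP := free_lift (fun c : P alpha n => subphrase_sum (repr c)).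
HB.instance Definition _ := GRing.Additive.on theta.

Lemma subphrase_sum_iso p q : isomorphic p q -> subphrase_sum p = subphrase_sum q.
Proof.
case=> f [f_inj alphq projq wordq]; rewrite /subphrase_sum alphq big_fpowerset_imfset //.
apply: eq_big_seq => S; rewrite fpowersetE => Sp; congr (<< _ >>).
by apply/eqP/iso_classP; apply: isomorphic_delete Sp.
Qed.

Lemma thetaE p : theta << iso_class p >> = subphrase_sum p.
Proof. by rewrite /theta free_liftE; apply/esym/subphrase_sum_iso/repr_iso_class. Qed.

Definition theta_quot : ZP -> G := quot_proj cyc_relator \o theta.
HB.instance Definition _ := GRing.Additive.on theta_quot.

Lemma theta_quot_shift i p :
  theta_quot << iso_class (shift nu i p) >> = theta_quot << iso_class p >>.
Proof.
rewrite /theta_quot /= !thetaE !raddf_sum; apply: eq_bigr => S _ /=.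
by case: (delete_shift nu i S p) => -> //; rewrite G_shift.
Qed.

Lemma theta_quot_relator r : cyc_relator r -> theta_quot r = 0.
Proof.
case=> [p q i A B x y wp wq wpq ppqA ppq|p q i A z wp Az wq wpq ppq].
  have /iso_classP/eqP <- := double_shift wp wq wpq ppqA ppq.
  by rewrite raddfB /= theta_quot_shift subrr.
by rewrite (single_shift wp Az wq wpq ppq) raddfB /= theta_quot_shift subrr.
Qed.

Definition thetahat : G -> G := quot_lift theta_quot_relator.
HB.instance Definition _ := GRing.Additive.on thetahat.

Lemma thetahatE x :
  thetahat (quot_proj cyc_relator x) = quot_proj cyc_relator (theta x).
Proof. exact: quot_liftE. Qed.

Variable m : nat.

Inductive rank_relator : G -> Prop :=
| HighRank p : (m < rank p)%N ->
    rank_relator (quot_proj cyc_relator << iso_class p >>).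

Definition Gm := zmod_quot rank_relator.
HB.instance Definition _ := GRing.Zmodule.on Gm.

Definition Ohat : G -> Gm := quot_proj rank_relator.
HB.instance Definition _ := GRing.Additive.on Ohat.

Definition Gamma : ZPC -> Gm := Ohat \o thetahat \o Ihat_inv.
HB.instance Definition _ := GRing.Additive.on Gamma.

End Gamma.

Section FiniteType.
Variables (alpha : choiceType) (n : nat).
Local Notation alpha2 := (alpha + alpha)%type.

Definition singular_letters (p : nanophrase alpha2 n) : {fset nat} :=
  [fset A in alphabet p | if (proj p).[? A] is Some (inr _) then true else false].

Definition nb_singular (p : nanophrase alpha2 n) : nat := #|` singular_letters p|.

Definition nonsingular (p : nanophrase alpha n) : nanophrase alpha2 n :=
  map_proj (fun _ => inl) p.

Definition unstar (A : nat) (p : nanophrase alpha2 n) : nanophrase alpha2 n :=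
  map_proj (fun B b => if b is inr a then if B == A then inl a else b else b) p.

Lemma singularP p A :
  (A \in singular_letters p) = if (proj p).[? A] is Some (inr _) then true else false.
Proof. by rewrite !inE /= /alphabet; case: fndP => [|//] Ap. Qed.

Lemma singular_unstar p A : singular_letters (unstar A p) = singular_letters p `\ A.
Proof.
apply/fsetP => B; rewrite !(singularP, inE) fnd_map_proj.
case: (proj p).[? B] => [[a|a]|] /=; rewrite ?andbF //.
by case: eqP.
Qed.

Lemma singular_delete p S : singular_letters (delete S p) = singular_letters p `\` S.
Proof.
by apply/fsetP => B; rewrite !(singularP, in_fsetD) fnd_delete; case: (B \in S).
Qed.

Definition all_unstarred (p : nanophrase alpha2 n) : nanophrase alpha n :=
  map_proj (fun _ b => match b with inl a => a | inr a => a end) p.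

Lemma nonsingularK : cancel nonsingular all_unstarred.
Proof.
by move=> p; apply: nanophrase_eqP => // A; rewrite !fnd_map_proj; case: fnd.
Qed.

Lemma all_unstarredK p : singular_letters p = fset0 -> nonsingular (all_unstarred p) = p.
Proof.
move=> sp; apply: nanophrase_eqP => // A; rewrite !fnd_map_proj.
have := singularP p A; rewrite sp inE.
by case: ((proj p).[? A]) => [[a|a]|].
Qed.

Lemma map_proj_iso (beta gamma : choiceType) (g : beta -> gamma) (p q : nanophrase beta n) :
  isomorphic p q -> isomorphic (map_proj (fun _ => g) p) (map_proj (fun _ => g) q).
Proof.
case=> f [f_inj alphq projq wordq]; exists f; split => //.
by move=> A Ap; rewrite !fnd_map_proj projq.
Qed.

Variables (nu : alpha -> alpha) (H : zmodType).
Implicit Types (u : PC nu n -> H) (uhat : PC (star nu) n -> H).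

Definition is_extension u uhat : Prop :=
  (forall p : nanophrase alpha n,
     uhat (cyc_class _ (nonsingular p)) = u (cyc_class _ p)) /\
  (forall (p : nanophrase alpha2 n) (A : nat), A \in singular_letters p ->
     uhat (cyc_class _ p) =
       uhat (cyc_class _ (unstar A p)) - uhat (cyc_class _ (delete [fset A] p))).

Lemma extension_unique u uhat1 uhat2 :
  is_extension u uhat1 -> is_extension u uhat2 -> uhat1 = uhat2.
Proof.
move=> [e1 s1] [e2 s2]; apply/funext => c; rewrite -[c]reprK; move: (repr c) => p {c}.
rewrite -/(cyc_class _ p); have [k] := ubnP (nb_singular p).
elim: k p => // k IH p pk; have [sp|/fset0Pn[A Ap]] := eqVneq (singular_letters p) fset0.
  by rewrite -(all_unstarredK sp) e1 e2.
have lt_k : (#|` singular_letters p `\ A| < k)%N.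
  by move: pk; rewrite /nb_singular (cardfsD1 A) Ap.
rewrite (s1 _ _ Ap) (s2 _ _ Ap) !IH //.
  by rewrite /nb_singular singular_delete.
by rewrite /nb_singular singular_unstar.
Qed.

Definition alternating_sum u (p : nanophrase alpha2 n) : H :=
  \sum_(S <- fpowerset (singular_letters p))
     u (cyc_class nu (all_unstarred (delete S p))) *~ (-1) ^+ #|` S|.

Lemma alternating_sum_iso u p q :
  isomorphic p q -> alternating_sum u p = alternating_sum u q.
Proof.
case=> f [f_inj alphq projq wordq]; rewrite /alternating_sum.
have sub A : A \in singular_letters p -> A \in alphabet p by rewrite inE /= => /andP[].
have -> : singular_letters q = f @` singular_letters p.
  apply/fsetP => B; rewrite inE /= alphq; apply/andP/imfsetP => /= [[/imfsetP[/= A Ap ->]]|].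
    by rewrite projq // => As; exists A; rewrite // singularP.
  case=> A As ->; have Ap := sub _ As.
  by split; [apply: in_imfset | rewrite projq // -singularP].
rewrite big_fpowerset_imfset; last by move=> A B /sub Ap /sub Bp; apply: f_inj.
apply: eq_big_seq => S; rewrite fpowersetE => /fsubsetP Sp.
have SP : S `<=` alphabet p by apply/fsubsetP => A /Sp /sub.
rewrite card_in_imfset /=; last first.
  by move=> A B /Sp/sub Ap /Sp/sub Bp; apply: f_inj.
congr (u _ *~ _); apply: cyc_class_iso; apply: map_proj_iso.
exact: isomorphic_delete SP.
Qed.

Lemma all_unstarred_shift i p :
  all_unstarred (shift (star nu) i p) = shift nu i (all_unstarred p).
Proof.
apply: nanophrase_eqP => [j|A]; first by rewrite word_map_proj !word_shift.
rewrite [LHS]fnd_map_proj !fnd_shift fnd_map_proj word_map_proj.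
by case: ((proj p).[? A]) => [[a|a]|] //=; case: ifP.
Qed.

Lemma alternating_sum_shift u i p :
  alternating_sum u (shift (star nu) i p) = alternating_sum u p.
Proof.
rewrite /alternating_sum.
have -> : singular_letters (shift (star nu) i p) = singular_letters p.
  apply/fsetP => A; rewrite !singularP fnd_shift.
  by case: ((proj p).[? A]) => [[a|a]|] //=; case: ifP.
apply: eq_bigr => S _; congr (u _ *~ _).
by case: (delete_shift (star nu) i S p) => -> //; rewrite all_unstarred_shift cyc_class_shift.
Qed.

Lemma alternating_sum_cyc u p q :
  cyc_equivalent (star nu) p q -> alternating_sum u p = alternating_sum u q.
Proof.
elim=> {p q} [p q [|[i ->]]|//|p q _ -> //|p q r _ -> _ -> //].
  exact: alternating_sum_iso.
by rewrite alternating_sum_shift.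
Qed.

Lemma big_fpowersetU1 (A : nat) (X : {fset nat}) (F : {fset nat} -> H) : A \notin X ->
  \sum_(S <- fpowerset (A |` X)) F S =
  \sum_(S <- fpowerset X) F S + \sum_(S <- fpowerset X) F (A |` S).
Proof.
move=> AX; rewrite -(big_map (fun S => A |` S) xpredT F) -big_cat.
have notin S : S `<=` X -> A \notin S.
  by move=> /fsubsetP SX; apply: contra AX => /SX.
apply: perm_big; apply: uniq_perm; first exact: fset_uniq.
  rewrite cat_uniq fset_uniq /=; apply/andP; split.
    apply/hasPn => _ /mapP[S _ ->] /=; rewrite fpowersetE.
    by apply/negP => /fsubsetP/(_ A); rewrite !inE eqxx /= => /(_ isT); apply/negP.
  rewrite map_inj_in_uniq ?fset_uniq // => S T; rewrite !fpowersetE => /notin SA /notin TA e.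
  by rewrite -(fsetU1K SA) -(fsetU1K TA) e.
move=> S; rewrite mem_cat !fpowersetE.
have [AS|AS] := boolP (A \in S).
  have -> : (S `<=` X) = false.
    by apply/negP => /notin; rewrite AS.
  apply/idP/mapP => [SX|[T]]; last first.
    by rewrite fpowersetE => TX ->; apply: fsetUS.
  by exists (S `\ A); rewrite ?fsetD1K // fpowersetE fsubDset.
rewrite [X in _ || X](_ : _ = false) ?orbF; last first.
  by apply/mapP => -[T _ e]; move: AS; rewrite e !inE eqxx.
apply/idP/idP => [/fsubsetP SX|/fsubset_trans]; last by apply; apply: fsubsetU1.
apply/fsubsetP => B BS; have := SX _ BS; rewrite !inE => /orP[/eqP e|//].
by move: AS; rewrite -e BS.
Qed.

Lemma alternating_sum_skein u p A : A \in singular_letters p ->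
  alternating_sum u p =
  alternating_sum u (unstar A p) - alternating_sum u (delete [fset A] p).
Proof.
move=> As; rewrite /alternating_sum singular_unstar singular_delete.
rewrite -[in LHS](fsetD1K As) big_fpowersetU1 ?inE ?eqxx // -sumrN.
congr (_ + _).
  apply: eq_bigr => S _; congr (u (cyc_class _ _) *~ _).
  apply: nanophrase_eqP => // B; rewrite !(fnd_map_proj, fnd_delete).
  case: (B \in S) => //; case: ((proj p).[? B]) => [[a|a]|] //=.
  by case: ifP.
apply: eq_big_seq => S; rewrite fpowersetE => /fsubsetP SA.
have AS : A \notin S by apply/negP => /SA; rewrite !inE eqxx.
rewrite cardfsU1 AS exprS mulN1r mulrNz; congr (- (u (cyc_class _ _) *~ _)).
apply: nanophrase_eqP => [i|B]; last first.
  by rewrite !(fnd_map_proj, fnd_delete) !inE; case: eqP => // _; case: (B \in S).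
rewrite !word_map_proj !word_delete -filter_predI; apply: eq_filter => B.
by rewrite /= !inE negb_or andbC.
Qed.

Lemma extension_exists u : exists uhat, is_extension u uhat.
Proof.
exists (fun c => alternating_sum u (repr c)).
have E p : alternating_sum u (repr (cyc_class (star nu) p)) = alternating_sum u p.
  by apply: alternating_sum_cyc; apply/cyc_classP; rewrite /cyc_class reprK.
split => [p|p A As]; rewrite !E; last exact: alternating_sum_skein.
have s0 : singular_letters (nonsingular p) = fset0.
  apply/fsetP => A; rewrite singularP inE fnd_map_proj.
  by case: ((proj p).[? A]).
rewrite /alternating_sum s0 fpowerset0 big_seq_fset1 cardfs0 expr0 mulr1z.
congr (u (cyc_class _ _)); rewrite -[RHS]nonsingularK; congr all_unstarred.
apply: nanophrase_eqP => [i|A]; first by rewrite word_delete (eq_filter (a2 := predT)) ?filter_predT.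
by rewrite fnd_delete inE.
Qed.

Definition extension u : PC (star nu) n -> H := sval (cid (extension_exists u)).

Lemma extensionP u : is_extension u (extension u).
Proof. exact: svalP (cid (extension_exists u)). Qed.

Definition vanishes_above u (m : nat) : Prop :=
  forall p : nanophrase alpha2 n,
    (m < nb_singular p)%N -> extension u (cyc_class _ p) = 0.

Definition finite_type u : Prop := exists m, vanishes_above u m.

Definition has_degree u (m : nat) : Prop :=
  vanishes_above u m /\ forall k, vanishes_above u k -> (m <= k)%N.

End FiniteType.

Arguments Gm {alpha} nu n m.
Arguments Gamma {alpha} nu n m _.

(* Main.v *)
(** Write c(p) for the class of a phrase in [Gm].  The invariant sends [p] to
    the sum of the c(q) over the subphrases [q] of [p], so by inclusion-exclusion
    its extension to singular phrases keeps only the subphrases that contain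
    every singular letter; with more than [m] singular letters these all have
    rank above [m] and vanish.  Conversely, given [v] vanishing above [m], send
    c(p) to the extension of [v] at [p] with all its letters made singular:
    this kills the phrases of rank above [m], and the skein relation shows that
    summing it over all subphrases of [p] gives back [v p].  The degree is not
    smaller than [m] because counting the phrases of rank exactly [m] is well
    defined on [Gm] and detects c(AB...AB...). *)
Require Import Defs.
From mathcomp Require Import all_boot all_algebra.
From mathcomp Require Import freeg.
From mathcomp Require Import finmap generic_quotient.
From Stdlib Require Import Relation_Operators.

Set Implicit Arguments.
Unset Strict Implicit.
Unset Printing Implicit Defensive.

Import GRing.Theory.

Local Open Scope fset_scope.
Local Open Scope fmap_scope.
Local Open Scope ring_scope.

(** * Making every letter singular; deletion and starring *)

Section Starring.
Variables (alpha : choiceType) (n : nat).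
Implicit Types p : nanophrase alpha n.

Definition all_starred p : nanophrase (alpha + alpha)%type n :=
  map_proj (fun _ => inr) p.

Lemma all_starredK : cancel all_starred (@all_unstarred alpha n).
Proof.
by move=> p; apply: nanophrase_eqP => // A; rewrite !fnd_map_proj; case: fnd.
Qed.

Lemma alphabet_all_starred p : alphabet (all_starred p) = alphabet p.
Proof. by []. Qed.

Lemma singular_all_starred p : singular_letters (all_starred p) = alphabet p.
Proof.
apply/fsetP => A; rewrite singularP fnd_map_proj /alphabet.
by case: fndP.
Qed.

Lemma delete_all_starred S p :
  delete S (all_starred p) = all_starred (delete S p).
Proof.
apply: nanophrase_eqP => [i|A]; first by rewrite word_delete; exact/esym/word_delete.
by rewrite fnd_delete [RHS]fnd_map_proj [in RHS]fnd_delete fnd_map_proj; case: ifP.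
Qed.

(** [star nu] acts on the starred copy as [nu] does on [alpha], so starring commutes with shifts. *)
Lemma all_starred_cyc (nu : alpha -> alpha) p q :
  cyc_equivalent nu p q ->
  cyc_equivalent (star nu) (all_starred p) (all_starred q).
Proof.
elim=> {p q} [p q [pq|[i ->]]|p|p q _ pq|p q r _ pq _ qr].
- by apply: rst_step; left; apply: map_proj_iso.
- apply: rst_step; right; exists i; apply: nanophrase_eqP => [j|A].
    by rewrite [RHS]word_shift; exact: word_shift.
  rewrite [LHS]fnd_map_proj !fnd_shift fnd_map_proj word_map_proj.
  by case: ((proj p).[? A]) => //= a; case: ifP.
- exact: rst_refl.
- exact: rst_sym.
- exact: rst_trans qr.
Qed.

Lemma delete0 (beta : choiceType) (p : nanophrase beta n) : delete fset0 p = p.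
Proof.
apply: nanophrase_eqP => [i|A]; last by rewrite fnd_delete inE.
by rewrite word_delete (eq_filter (a2 := predT)) ?filter_predT // => A; rewrite inE.
Qed.

Lemma unstar_delete (p : nanophrase (alpha + alpha)%type n) A S :
  unstar A (delete S p) = delete S (unstar A p).
Proof.
apply: nanophrase_eqP => [i|B]; first by rewrite [RHS]word_delete; exact: word_delete.
by rewrite fnd_map_proj [in LHS]fnd_delete [RHS]fnd_delete fnd_map_proj; case: ifP.
Qed.

Lemma delete_delete (beta : choiceType) (p : nanophrase beta n) S T :
  delete S (delete T p) = delete (T `|` S) p.
Proof.
apply: nanophrase_eqP => [i|B].
  rewrite !word_delete -filter_predI; apply: eq_filter => B.
  by rewrite /= !inE negb_or andbC.
by rewrite !fnd_delete !inE; case: (B \in S); case: (B \in T).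
Qed.

Lemma all_unstarred_unstar (p : nanophrase (alpha + alpha)%type n) A :
  all_unstarred (unstar A p) = all_unstarred p.
Proof.
apply: nanophrase_eqP => // B; rewrite !fnd_map_proj.
by case: ((proj p).[? B]) => [[a|a]|] //=; case: ifP.
Qed.

Lemma sub_singular (p : nanophrase (alpha + alpha)%type n) :
  singular_letters p `<=` alphabet p.
Proof. by apply/fsubsetP => A; rewrite inE => /andP[]. Qed.

End Starring.

(** * Computing extensions and inverting the skein relation *)

Section Extension.
Variables (alpha : choiceType) (nu : alpha -> alpha) (n : nat) (H : zmodType).
Variable u : PC nu n -> H.
Local Notation alpha2 := (alpha + alpha)%type.
Implicit Types p : nanophrase alpha2 n.

(* Unlike in [extension_unique], [F] need not be invariant under shifts. *)
Lemma extensionE (F : nanophrase alpha2 n -> H) :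
  (forall q : nanophrase alpha n, F (nonsingular q) = u (cyc_class nu q)) ->
  (forall p A, A \in singular_letters p ->
     F p = F (unstar A p) - F (delete [fset A] p)) ->
  forall p, extension u (cyc_class (star nu) p) = F p.
Proof.
move=> F0 FS p; have [u0 uS] := extensionP u; have [k] := ubnP (nb_singular p).
elim: k p => // k IH p pk; have [sp|/fset0Pn[A Ap]] := eqVneq (singular_letters p) fset0.
  by rewrite -(all_unstarredK sp) u0 F0.
have lt_k : (#|` singular_letters p `\ A| < k)%N.
  by move: pk; rewrite /nb_singular (cardfsD1 A) Ap.
by rewrite (uS _ _ Ap) (FS _ _ Ap) !IH // /nb_singular ?singular_delete ?singular_unstar.
Qed.

(** Induction on the number of singular letters. For a singular [A], the skein relation merges the
    terms of a set [S] avoiding [A] and of [S] with [A] added into the term of [S] for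
    [unstar A p]. *)
Lemma sum_extension_delete p :
  \sum_(S <- fpowerset (singular_letters p))
     extension u (cyc_class (star nu) (delete S p)) =
  u (cyc_class nu (all_unstarred p)).
Proof.
have [u0 uS] := extensionP u; have [k] := ubnP (nb_singular p).
elim: k p => // k IH p pk; have [sp|/fset0Pn[A Ap]] := eqVneq (singular_letters p) fset0.
  rewrite sp fpowerset0 big_seq_fset1 delete0.
  by rewrite -{1}(all_unstarredK sp) u0.
rewrite -(fsetD1K Ap) big_fpowersetU1 ?fsetD11 //.
rewrite -big_split /= -(all_unstarred_unstar p A) -IH; last first.
  by move: pk; rewrite /nb_singular singular_unstar [X in (X < _)%N -> _](cardfsD1 A) Ap.
rewrite singular_unstar; apply: eq_big_seq => S; rewrite fpowersetE => /fsubsetP SX.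
rewrite -unstar_delete (uS (delete S p) A).
  by rewrite delete_delete fsetUC subrK.
by rewrite singular_delete inE Ap andbT; apply/negP => /SX; rewrite !inE eqxx.
Qed.

End Extension.

(** * Values of Gamma and universality *)

Section UniversalInvariant.
Variables (alpha : choiceType) (nu : alpha -> alpha) (n m : nat).
Implicit Types p : nanophrase alpha n.

Definition Gm_class p : Gm nu n m :=
  @Ohat _ nu n m (quot_proj (@cyc_relator _ nu n) << iso_class p >>).

Definition Gamma_inv : PC nu n -> Gm nu n m := fun c => Gamma nu n m << c >>.

Lemma Gm_class_rank p : (m < rank p)%N -> Gm_class p = 0.
Proof. by move=> mp; apply: quot_proj_eq0; apply: HighRank. Qed.

Lemma Gamma_inv_class p :
  Gamma_inv (cyc_class nu p) =
  \sum_(S <- fpowerset (alphabet p)) Gm_class (delete S p).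
Proof.
(* [Ihat_inv] is only a chosen preimage; it is computed by writing the class of [p] as a value of
   [Ihat]. *)
rewrite /Gamma_inv /Gamma /= -IhatE IhatK thetahatE thetaE /subphrase_sum.
by rewrite !raddf_sum.
Qed.

(** Universal property of [Gm]: [Ihat] identifies [G] with the free group on cyclic classes, so only
    the rank relations have to be killed. *)
Lemma Gm_lift (H : zmodType) (g : PC nu n -> H) :
  (forall p, (m < rank p)%N -> g (cyc_class nu p) = 0) ->
  exists f : {additive Gm nu n m -> H}, forall p, f (Gm_class p) = g (cyc_class nu p).
Proof.
move=> g0; pose h : {additive G nu n -> H} := free_lift g \o @Ihat alpha nu n.
have h_class p : h (quot_proj (@cyc_relator _ nu n) << iso_class p >>) = g (cyc_class nu p).
  by rewrite /h /= IhatE free_liftE.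
have h0 r : rank_relator m r -> h r = 0 by case=> p mp; rewrite h_class g0.
pose f : {additive Gm nu n m -> H} := quot_lift h0.
by exists f => p; rewrite -h_class; apply: quot_liftE.
Qed.

(** By [extensionE] it suffices to check the skein relation for the right-hand side. Among the sets
    of nonsingular letters of [unstar A p], those containing [A] give the value at [delete [fset A]
    p], the others the value at [p]. *)
Lemma extension_Gamma_inv (p : nanophrase (alpha + alpha)%type n) :
  extension Gamma_inv (cyc_class (star nu) p) =
  \sum_(S <- fpowerset (alphabet p `\` singular_letters p))
     Gm_class (all_unstarred (delete S p)).
Proof.
move: p; apply: extensionE => [p|p A As].
  rewrite Gamma_inv_class; have -> : singular_letters (nonsingular p) = fset0.
    apply/fsetP => A; rewrite singularP inE fnd_map_proj.
    by case: ((proj p).[? A]).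
  rewrite fsetD0; apply: eq_bigr => S _; congr Gm_class.
  rewrite -[RHS]nonsingularK; congr all_unstarred; apply: nanophrase_eqP => [i|A].
    by rewrite word_delete; exact/esym/word_delete.
  by rewrite fnd_delete [RHS]fnd_map_proj [in RHS]fnd_delete fnd_map_proj; case: ifP.
have Aa : A \in alphabet p by apply: fsubsetP As; apply: sub_singular.
rewrite singular_unstar singular_delete alphabet_delete.
have -> : alphabet (unstar A p) `\` (singular_letters p `\ A) =
          A |` (alphabet p `\` singular_letters p).
  apply/fsetP => B; rewrite !(in_fsetD, in_fset1U, in_fset1).
  rewrite -[alphabet (unstar A p)]/(alphabet p).
  by have [->|] := eqVneq B A; rewrite ?Aa.
have -> : (alphabet p `\ A) `\` (singular_letters p `\ A) =
          alphabet p `\` singular_letters p.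
  apply/fsetP => B; rewrite !(in_fsetD, in_fset1U, in_fset1).
  by have [->|] := eqVneq B A; rewrite /= ?As ?andbF.
rewrite big_fpowersetU1 ?in_fsetD ?As //.
rewrite [X in _ = _ + X - _](_ : _ =
  \sum_(S <- fpowerset (alphabet p `\` singular_letters p))
     Gm_class (all_unstarred (delete S (delete [fset A] p)))).
  by rewrite addrK; apply: eq_bigr => S _; rewrite -unstar_delete all_unstarred_unstar.
by apply: eq_bigr => S _; rewrite -unstar_delete all_unstarred_unstar delete_delete.
Qed.

Lemma vanishes_above_Gamma_inv : vanishes_above Gamma_inv m.
Proof.
move=> p mp; rewrite extension_Gamma_inv; apply: big1_seq => S /=.
rewrite fpowersetE => SX; apply: Gm_class_rank; apply: leq_trans mp _.
(* The set [S] avoids the singular letters, so all of them survive in [delete S p]. *)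
apply: fsubset_leq_card; rewrite [X in _ `<=` X](_ : _ = alphabet (delete S p)) //.
rewrite alphabet_delete; apply/fsubsetP => A As; rewrite inE.
rewrite (fsubsetP (sub_singular p) _ As) andbT.
by apply/negP => /(fsubsetP SX); rewrite inE As.
Qed.

Lemma Gamma_inv_universal (H : zmodType) (v : PC nu n -> H) :
  vanishes_above v m ->
  exists f : {additive Gm nu n m -> H}, forall c, v c = f (Gamma_inv c).
Proof.
move=> v0.
pose g (c : PC nu n) := extension v (cyc_class (star nu) (all_starred (repr c))).
have g_class p : g (cyc_class nu p) = extension v (cyc_class (star nu) (all_starred p)).
  congr extension; apply/eqP/cyc_classP/all_starred_cyc/cyc_classP.
  by rewrite /cyc_class reprK.
have [|f fE] := @Gm_lift H g.
  by move=> p mp; rewrite g_class v0 // /nb_singular singular_all_starred.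
exists f => c; rewrite -[c]reprK -/(cyc_class nu _); move: (repr c) => p.
(* Every letter of [all_starred p] is singular, so [sum_extension_delete] runs over all subphrases
   of [p]. *)
rewrite Gamma_inv_class raddf_sum /= -[p in LHS]all_starredK -sum_extension_delete.
rewrite singular_all_starred; apply: eq_bigr => S _.
by rewrite fE g_class delete_all_starred.
Qed.

(** * Minimality of the degree *)

Lemma rank_iso p q : isomorphic p q -> rank p = rank q.
Proof. by case=> f [f_inj alphq _ _]; rewrite /rank alphq card_in_imfset. Qed.

Lemma rank_cyc p q : cyc_equivalent nu p q -> rank p = rank q.
Proof.
elim=> {p q} [p q [/rank_iso//|[i ->]]|//|p q _ -> //|p q r _ -> _ -> //].
by [].
Qed.

(** Detected by the homomorphism to the integers induced by the indicator of rank [m]. *)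
Lemma Gm_class_neq0 p : rank p = m -> Gm_class p != 0.
Proof.
move=> pm; pose g (c : PC nu n) : int := (rank (repr c) == m)%:R.
have g_class q : g (cyc_class nu q) = (rank q == m)%:R.
  congr (_ == m)%:R; apply/rank_cyc/cyc_classP.
  by rewrite /cyc_class reprK.
have [|f fE] := @Gm_lift int g; first by move=> q mq; rewrite g_class gtn_eqF.
by apply/eqP => p0; have := fE p; rewrite p0 raddf0 g_class pm eqxx.
Qed.

Lemma exists_rank (k : nat) : (0 < n)%N -> alpha -> exists p, rank p = k.
Proof.
move=> n0 a; pose w : {ffun 'I_n -> seq nat} :=
  [ffun i => if i == Ordinal n0 then iota 0 k ++ iota 0 k else [::]].
pose f := [fmap A : [fset A in iota 0 k] => a].
have ax : nanophrase_axiom (w, f).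
  apply: nanophrase_axiomP => A; rewrite (bigD1 (Ordinal n0)) //= big1 => [|i ni].
    rewrite ffunE eqxx count_cat addn0 addnn count_uniq_mem ?iota_uniq //.
    by rewrite !inE.
  by rewrite ffunE (negPf ni).
exists (Nanophrase _ ax); rewrite /rank /alphabet /=.
by rewrite card_fseq undup_id ?iota_uniq // size_iota.
Qed.

(** For [p] of rank [m], the extension at [all_starred p] has the single term [Gm_class p], which is
    nonzero. *)
Lemma degree_Gamma_inv_ge (k : nat) : (0 < n)%N -> alpha ->
  vanishes_above Gamma_inv k -> (m <= k)%N.
Proof.
move=> n0 a vk; rewrite leqNgt; apply/negP => km.
have [p pm] := exists_rank m n0 a.
suff : Gm_class p = 0 by apply/eqP/Gm_class_neq0.
have := vk (all_starred p); rewrite /nb_singular singular_all_starred => /(_ _)<- //; last first.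
  by rewrite -/(rank p) pm.
rewrite extension_Gamma_inv singular_all_starred alphabet_all_starred fsetDv.
by rewrite fpowerset0 big_seq_fset1 delete0 all_starredK.
Qed.

End UniversalInvariant.

(** If [n] is 0 or [alpha] is empty, the empty phrase is the only one and every invariant has degree
    0; hence the condition under which the degree is exactly [m]. *)
Theorem theorem5p4 (alpha : finType) (nu : alpha -> alpha) (n m : nat)
    (nuK : involutive nu) :
  let Gam : {additive {freeg (PC nu n) / int} -> Gm nu n m} := Gamma nu n m in
  let gam : PC nu n -> Gm nu n m := fun c => Gam << c >> in
  [/\ vanishes_above gam m,
      (m = 0%N \/ (0 < n)%N /\ (0 < #|alpha|)%N) -> has_degree gam m
    & forall (H : zmodType) (v : PC nu n -> H) (d : nat),
        has_degree v d -> (d <= m)%N ->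
        exists f : {additive Gm nu n m -> H}, forall c, v c = f (gam c)].
Proof.
move=> Gam gam; split=> [|nontriv|H v d [vd _] dm].
- exact: vanishes_above_Gamma_inv.
- split=> [|k vk]; first exact: vanishes_above_Gamma_inv.
  case: nontriv => [->//|[n0 /card_gt0P[a _]]].
  exact: degree_Gamma_inv_ge n0 a vk.
by apply: Gamma_inv_universal => p mp; apply: vd; apply: leq_ltn_trans mp.
Qed.
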